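(* Let $m,d\ge1$ be integers, let $V=\{v(x),\ x\in\mathbb{R}^m\}$ be an $\mathbb{R}^d$-valued stochastic process with continuous sample paths, and let $I\subset\mathbb{R}^m$ be a compact set of positive Lebesgue measure. Fix $\delta>0$, let $D\subset\mathbb{R}^d$ and $\gamma>0$. For $\varepsilon\in\,]0,1[$ and $j=(j_1,\dots,j_m)\in\mathbb{Z}^m$ set $$R_j^\varepsilon=\prod_{l=1}^m\left[j_l\,\varepsilon^{1/\delta},(j_l+1)\,\varepsilon^{1/\delta}\right].$$ Assume that there exists a positive constant $c$ such that, for all small $\varepsilon\in\,]0,1[$, all $z\in D^{(1)}$ and any set $R_j^\varepsilon$ such that $R_j^\varepsilon\cap I\ne\varnothing$, $$P\{v(R_j^\varepsilon)\cap B_\varepsilon(z)\ne\varnothing\}\le c\,\varepsilon^\gamma.$$ Then there exists a positive constant $C$ such that for any Borel set $A\subset D$, $$P\{v(I)\cap A\ne\varnothing\}\le C\,\mathcal{H}_{\gamma-\frac{m}{\delta}}(A).$$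
   Context: For a set $S$, $v(S)$ denotes its (random) image under $x\mapsto v(x)$. $B_r(x)$ is the open Euclidean ball with center $x$ and radius $r$. For $S\subset\mathbb{R}^n$ and $\nu>0$, $S^{(\nu)}$ is the $\nu$-enlargement of $S$, i.e. the set of points at distance less than $\nu$ from $S$. Hausdorff measure: for a Borel set $A\subset\mathbb{R}^d$, $\mathcal{H}_\gamma(A)=\infty$ if $\gamma<0$, and for $\gamma\ge0$, $$\mathcal{H}_\gamma(A)=\lim_{\varepsilon\to0^+}\inf\left\{\sum_{i=1}^\infty(2r_i)^\gamma:\ A\subset\bigcup_{i=1}^\infty B_{r_i}(x_i),\ \sup_{i\ge1}r_i\le\varepsilon\right\}.$$ *)

(* Defs.v *)
From HB Require Import structures.
From mathcomp Require Import all_boot all_order all_algebra.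
From mathcomp Require Import all_classical all_reals all_analysis.

Set Implicit Arguments.
Unset Strict Implicit.
Unset Printing Implicit Defensive.

Import Order.TTheory GRing.Theory Num.Theory.
Import numFieldNormedType.Exports.

Local Open Scope classical_set_scope.
Local Open Scope ring_scope.

                                                                         
                                                                            
                                               
Definition enorm (R : realType) (n : nat) (x : 'rV[R]_n) : R :=
  Num.sqrt (\sum_(i < n) x ord0 i ^+ 2).

Definition eball (R : realType) (n : nat) (x : 'rV[R]_n) (r : R)
  : set 'rV[R]_n := [set y | enorm (y - x) < r].

Definition enlargement (R : realType) (n : nat) (S : set 'rV[R]_n) (nu : R)
  : set 'rV[R]_n := [set y | exists2 x, S x & enorm (y - x) < nu].

                                       
Definition borel_rV (R : realType) (n : nat) :=
  g_sigma_algebraType (@open 'rV[R]_n).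

Definition closed_box (R : realType) (n : nat) (a b : 'rV[R]_n)
  : set 'rV[R]_n :=
  [set x | forall l : 'I_n, a ord0 l <= x ord0 l <= b ord0 l].

                                                                          
                                                          
Definition lebesgue_rV (R : realType) (n : nat) (A : set 'rV[R]_n) : \bar R :=
  ereal_inf [set s | exists a b : nat -> 'rV[R]_n,
    [/\ forall (i : nat) (l : 'I_n), a i ord0 l <= b i ord0 l,
        A `<=` \bigcup_i closed_box (a i) (b i) &
        s = (\sum_(0 <= i <oo)
               (\prod_(l < n) (b i ord0 l - a i ord0 l))%:E)%E]].

                                                                     
                                                                          
                                                                              
                          
Definition hausdorff_weight (R : realType) (g r : R) : R :=
  if r == 0 then 0 else (2 * r) `^ g.

Definition hausdorff_pre (R : realType) (n : nat) (g e : R)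
    (A : set 'rV[R]_n) : \bar R :=
  ereal_inf [set s | exists (x : nat -> 'rV[R]_n) (r : nat -> R),
    [/\ forall i, 0 <= r i <= e,
        A `<=` \bigcup_i eball (x i) (r i) &
        s = (\sum_(0 <= i <oo) (hausdorff_weight g (r i))%:E)%E]].

Definition hausdorff (R : realType) (n : nat) (g : R) (A : set 'rV[R]_n)
  : \bar R :=
  if g < 0 then +oo%E else lim (hausdorff_pre g e A @[e --> 0^'+]).

                                   
Definition grid_box (R : realType) (m : nat) (delta e : R) (j : 'I_m -> int)
  : set 'rV[R]_m :=
  closed_box (\row_l ((j l)%:~R * e `^ (1 / delta)))
             (\row_l ((j l + 1)%:~R * e `^ (1 / delta))).

                                                                        
Definition hits (R : realType) (m d : nat) (T : Type)
    (v : 'rV[R]_m -> T -> 'rV[R]_d) (S : set 'rV[R]_m) (B : set 'rV[R]_d)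
  : set T :=
  [set w | (v^~ w @` S) `&` B !=set0].

(* Main.v *)
Require Import Defs.
From HB Require Import structures.
From mathcomp Require Import all_boot all_order all_algebra.
From mathcomp Require Import all_classical all_reals all_analysis.
From mathcomp Require Import ring lra.
Set Implicit Arguments.
Unset Strict Implicit.
Unset Printing Implicit Defensive.
Import Order.TTheory GRing.Theory Num.Theory.
Import numFieldNormedType.Exports.
Local Open Scope classical_set_scope.
Local Open Scope ring_scope.

(** Cover [A] by balls of radii [r i].  For the path to hit [A] on the index
    set [I], it must hit one of these balls; the idea is to discretise [I] at
    the scale that belongs to each ball separately.  At scale [r], the bounded
    set [I] is covered by at most a constant times [r `^ (- m / delta)] boxes
    of the grid of step [r `^ (1 / delta)], and the hypothesis bounds by
    [c * r `^ gamma] the probability that the path hits the ball on any one of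
    these boxes that meets [I].  Hence a ball of radius [r] is hit on [I] with
    probability at most [C * r `^ (gamma - m / delta)] (lemma [hits_ball_cover], with the counting
    done in [grid_cover]).  Summing over the balls gives [C] times the sum that
    defines the Hausdorff premeasure, up to a factor [2 `^ g >= 1].  The
    hypothesis speaks of centers at distance less than 1 from [D]: balls that
    miss [A] are discarded, and the center of any other ball of the cover is
    within its radius of a point of [A].

    The hitting events of [A] need not be measurable, so each ball is given a
    measurable event that contains its hitting event: a finite union of events
    of the form: the path hits an open ball on a nondegenerate closed box.
    Those are measurable because, by continuity of the path, it suffices to
    look at the countably many rational points of the box
    ([measurable_hits_box]).  The outer measure is then bounded straight from
    its definition by countable covers.

    Finally, a bound by the premeasure at a single scale is enough, since the
    premeasures increase to the Hausdorff measure when the scale decreases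
    ([hausdorff_pre_le]).  For a negative dimension the right-hand side is
    infinite. *)

(** * Euclidean balls *)

Lemma enorm_ge0 (R : realType) n (x : 'rV[R]_n) : 0 <= enorm x.
Proof. exact: sqrtr_ge0. Qed.

Lemma enorm_distC (R : realType) n (x y : 'rV[R]_n) :
  enorm (x - y) = enorm (y - x).
Proof.
by congr Num.sqrt; apply: eq_bigr => i _; rewrite !mxE -opprB sqrrN.
Qed.

(** The topology of ['rV[R]_n] is that of the sup norm, so openness of
    Euclidean balls comes from continuity of the Euclidean norm. *)
Lemma open_eball (R : realType) n (z : 'rV[R]_n) (r : R) : open (eball z r).
Proof.
suff cf : continuous (fun y : 'rV[R]_n => enorm (y - z)).
  rewrite [eball z r](_ : _ = (fun y => enorm (y - z)) @^-1` [set t | t < r]) //.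
  by apply: open_comp => [y _|]; [exact: cf | exact: open_lt].
have -> : (fun y : 'rV[R]_n => enorm (y - z)) =
    (@Num.sqrt R \o (fun y : 'rV[R]_n => \sum_(i < n) (y ord0 i - z ord0 i) ^+ 2)).
  by apply/funext => y /=; congr Num.sqrt; apply: eq_bigr => i _; rewrite !mxE.
move=> y; apply: continuous_comp; last exact: sqrt_continuous.
apply: continuous_big => [|i _ w]; first exact: add_continuous.
apply: (@continuous_comp _ _ _ (fun y : 'rV[R]_n => y ord0 i)
  (fun t : R => (t - z ord0 i) ^+ 2)); first exact: coord_continuous.
apply: (@continuous_comp _ _ _ (fun t : R => t - z ord0 i)
  (fun t : R => t ^+ 2)); last exact: exprn_continuous.
by apply: cvgB; [exact: cvg_id | exact: cvg_cst].
Qed.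

(** * Measurability of hitting events *)

(** The box may have [x] on its boundary; nondegeneracy in every coordinate is
    what leaves room for rational points of the box near [x]. *)
Lemma closed_box_rat_dense (R : realType) m (a b x : 'rV[R]_m)
    (U : set 'rV[R]_m) :
  (forall l, a ord0 l < b ord0 l) -> closed_box a b x -> nbhs x U ->
  exists q : 'rV[rat]_m,
    closed_box a b (map_mx ratr q) /\ U (map_mx ratr q).
Proof.
move=> ab abx /nbhs_ballP[e /= e0 eU].
have qP l : exists q : rat, ratr q \in
    `]Num.max (a ord0 l) (x ord0 l - e), Num.min (b ord0 l) (x ord0 l + e)[.
  apply: rat_in_itvoo; have := ab l; have /andP[] := abx l.
  by rewrite gt_max !lt_min => *; apply/andP; split; apply/andP; split; lra.
pose q := \row_l xchoose (qP l).
have qE l : (map_mx ratr q : 'rV[R]_m) ord0 l = ratr (xchoose (qP l)).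
  by rewrite !mxE.
exists q; split.
  move=> l; rewrite qE; have := xchooseP (qP l).
  rewrite in_itv /= gt_max lt_min => /andP[/andP[al _] /andP[bl _]].
  by rewrite !ltW.
apply: eU; split => // i l; rewrite ord1 qE; have := xchooseP (qP l).
rewrite in_itv /= gt_max lt_min => /andP[/andP[_ xl] /andP[_ xr]].
by rewrite /ball /= ltr_norml; apply/andP; split; lra.
Qed.

(** By continuity of [v ^~ w], the path hits the open set [B] on the box iff it
    is in [B] at some rational point of the box, so the event is a countable
    union of measurable events. *)
Lemma measurable_hits_box (R : realType) disp (T : measurableType disp)
    m d (v : 'rV[R]_m -> T -> 'rV[R]_d) (a b : 'rV[R]_m) (B : set 'rV[R]_d) :
  (forall x, measurable_fun [set: T] (v x : T -> borel_rV R d)) ->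
  (forall w, continuous (fun x => v x w)) ->
  (forall l, a ord0 l < b ord0 l) -> open B ->
  measurable (hits v (closed_box a b) B).
Proof.
move=> v_rv v_cont ab oB.
pose F (q : 'rV[rat]_m) : set T :=
  if `[< closed_box a b (map_mx ratr q) >] then v (map_mx ratr q) @^-1` B
  else set0.
have -> : hits v (closed_box a b) B = \bigcup_q F q.
  apply/seteqP; split=> w /=.
    move=> [y [[x abx <-] Bx]].
    have nU : nbhs x [set y | B (v y w)].
      by apply: v_cont; exact: open_nbhs_nbhs.
    have [q [abq Bq]] := closed_box_rat_dense ab abx nU.
    by exists q => //; rewrite /F; case: asboolP.
  move=> [q _]; rewrite /F; case: asboolP => // abq Bq.
  by exists (v (map_mx ratr q) w); split => //; exists (map_mx ratr q).
apply: countable_bigcupT_measurable => [|q]; first exact: countableP.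
rewrite /F; case: asboolP => // _; rewrite -[_ @^-1` _]setTI.
by apply: v_rv => //; exact: sub_sigma_algebra.
Qed.

Lemma probability_bigsetU_le (R : realType) disp (T : measurableType disp)
    (P : probability T R) (J : Type) (s : seq J) (F : J -> set T) (b : R) :
  (forall j, measurable (F j)) -> (forall j, (P (F j) <= b%:E)%E) ->
  (P (\big[setU/set0]_(j <- s) F j) <= ((size s)%:R * b)%:E)%E.
Proof.
move=> mF Fb; elim: s => [|j s IHs]; first by rewrite big_nil measure0 mul0r.
rewrite big_cons.
apply: (le_trans (measureU2 _ _ _)) => //; first exact: bigsetU_measurable.
by rewrite /= -natr1 addrC mulrDl mul1r EFinD leeD.
Qed.

(** * Hausdorff premeasures *)

Lemma hausdorff_weight_ge0 (R : realType) (g r : R) :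
  0 <= hausdorff_weight g r.
Proof. by rewrite /hausdorff_weight; case: ifP; rewrite ?powR_ge0. Qed.

(** A smaller scale allows fewer covers, so the premeasures are nonincreasing
    in [e]; their limit at [0] exists and is their supremum. *)
Lemma hausdorff_pre_le (R : realType) n (g e : R) (A : set 'rV[R]_n) :
  0 <= g -> 0 < e -> (hausdorff_pre g e A <= hausdorff g A)%E.
Proof.
move=> g0 e0; rewrite /hausdorff ltNge g0 /=.
have mono : {in `]0, +oo[ &, {homo (fun e => hausdorff_pre g e A) :
    s t / s <= t >-> (t <= s)%E}}.
  move=> s t _ _ st; apply: ereal_inf_le_tmp => _ [x [r [rs Ar ->]]].
  exists x, r; split => // i; have /andP[-> /=] := rs i.
  by move/le_trans; apply.
rewrite (cvg_lim _ (nonincreasing_at_right_cvge _ _ mono)) //.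
by apply: ereal_sup_ubound; exists e => //=; rewrite in_itv /= e0.
Qed.

(** * Counting grid boxes *)

Lemma compact_coord_bounded (R : realType) m (I : set 'rV[R]_m) :
  compact I ->
  exists2 M : R, 0 < M & forall x l, I x -> `|x ord0 l| <= M.
Proof.
move=> cI.
have bI l : \forall M \near +oo, forall x, I x -> `|x ord0 l| <= M.
  have : compact ((fun x : 'rV[R]_m => x ord0 l) @` I).
    apply: (@continuous_compact 'rV[R]_m R) => //.
    by apply: (@continuous_subspaceT 'rV[R]_m R) => x; exact: coord_continuous.
  move=> /(@compact_bounded R R^o)[M [Mr bM]]; exists M; split=> // N MN x Ix.
  by apply: (bM N MN); exists x.
near +oo_R => M; exists M; first by near: M; exact: nbhs_pinfty_gt.
move=> x l; move: l x; near: M.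
by apply: filter_forall => l; exact: bI.
Unshelve. all: by end_near.
Qed.

(** One coordinate of the counting: the [N] intervals [[(k - L) s, (k - L + 1) s]]
    cover [[-M, M]].  As [s <= 1], the bound on [N] is of the pure form
    constant over [s], whose [m]-th power bounds the number of boxes. *)
Lemma grid_cover (R : realType) (M s : R) : 0 < M -> 0 < s <= 1 ->
  exists N L : nat, N%:R <= (2 * M + 2) / s /\
    forall y : R, `|y| <= M -> exists k : 'I_N,
      ((k : nat)%:Z - L%:Z)%:~R * s <= y <= ((k : nat)%:Z - L%:Z + 1)%:~R * s.
Proof.
move=> M0 /andP[s0 s1].
have Ms0 : 0 <= M / s by rewrite divr_ge0 ?ltW.
(* [L] is the least natural number with [M / s < L]. *)
pose L := (Num.truncn (M / s)).+1.
have /andP[L1 L2] := truncn_itv Ms0.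
exists (L.*2), L; split.
  rewrite -muln2 natrM /L -natr1.
  have : 1 <= s^-1 by rewrite invf_ge1.
  move: L1; rewrite [(_ + _) / s]mulrDl -mulrA; lra.
move=> y yM; set j := Num.floor (y / s).
have /andP[j1 j2] := floor_itv (y / s).
have /andP[y1 y2] : - (M / s) <= y / s <= M / s.
  by rewrite -mulNr !ler_pM2r ?invr_gt0 // -ler_norml.
have jL : - L%:Z <= j.
  by rewrite floor_ge_int rmorphN /=; apply: le_trans y1; rewrite lerN2 ltW.
have jU : j < L%:Z.
  rewrite -(ltr_int R); apply: le_lt_trans j1 _; exact: le_lt_trans y2 L2.
have kP : (`|(j + L%:Z)%R|%N < L.*2)%N.
  by rewrite -ltz_nat gez0_abs -?addnn ?PoszD; lra.
exists (Ordinal kP) => /=.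
rewrite gez0_abs; last by lra.
rewrite addrK; apply/andP; split; first by rewrite -ler_pdivlMr.
by rewrite -ler_pdivrMr // ltW.
Qed.

(** * Hitting a small ball *)

(** [U] is the union of the hitting events over those boxes of a finite grid
    cover of the cube [|x_l| <= M] that meet [I].  Counting gives at most
    [((2 * M + 2) / s) ^+ m] boxes for the grid step
    [s = r `^ (1 / delta)], and [s ^+ m] is [r `^ (m / delta)]. *)
Lemma hits_ball_cover (R : realType) disp (T : measurableType disp)
    (P : probability T R) m d (v : 'rV[R]_m -> T -> 'rV[R]_d)
    (I : set 'rV[R]_m) (delta gamma c M : R) (z : 'rV[R]_d) (r : R) :
  (forall x, measurable_fun [set: T] (v x : T -> borel_rV R d)) ->
  (forall w, continuous (fun x => v x w)) ->
  0 < delta -> 0 < c -> 0 < M -> (forall x l, I x -> `|x ord0 l| <= M) ->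
  0 < r <= 1 ->
  (forall j, grid_box delta r j `&` I !=set0 ->
     (P (hits v (grid_box delta r j) (eball z r)) <= (c * r `^ gamma)%:E)%E) ->
  exists U : set T, [/\ measurable U, hits v I (eball z r) `<=` U &
    (P U <= (c * (2 * M + 2) ^+ m * r `^ (gamma - m%:R / delta))%:E)%E].
Proof.
move=> v_rv v_cont delta0 c0 M0 IM /andP[r0 r1] hb.
pose s := r `^ (1 / delta).
have s0 : 0 < s by rewrite powR_gt0.
have s1 : s <= 1.
  by rewrite -(powRr0 r) ger_powR ?r0 // divr_ge0 // ltW.
have [|N [L [NL cov]]] := @grid_cover R M s M0; first by rewrite s0.
pose j (k : {ffun 'I_m -> 'I_N}) l : int := (k l : nat)%:Z - L%:Z.
(* Boxes that miss [I] contribute [set0]: [hb] is silent about them. *)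
pose F k := if `[< grid_box delta r (j k) `&` I !=set0 >]
  then hits v (grid_box delta r (j k)) (eball z r) else set0.
have cr0 : 0 <= c * r `^ gamma by rewrite mulr_ge0 ?powR_ge0 // ltW.
have mF k : measurable (F k).
  rewrite /F; case: asboolP => // _; apply: measurable_hits_box => // [l|].
    by rewrite !mxE ltr_pM2r // ltr_int ltrDl.
  exact: open_eball.
exists (\big[setU/set0]_k F k); split.
- exact: bigsetU_measurable.
- move=> w [_ [[x Ix <-] Bx]].
  have kP l : exists k : 'I_N, ((k : nat)%:Z - L%:Z)%:~R * s <= x ord0 l <=
      ((k : nat)%:Z - L%:Z + 1)%:~R * s by apply/cov/IM.
  pose k := [ffun l => xchoose (kP l)].
  have bx : grid_box delta r (j k) x.
    by move=> l; rewrite !mxE /j ffunE; exact: xchooseP (kP l).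
  rewrite (bigD1 k) //=; left.
  rewrite /F; case: asboolP => [_|[]]; last by exists x.
  by exists (v x w); split => //; exists x.
- apply: le_trans (probability_bigsetU_le (b := c * r `^ gamma) _ _ _) _ => //.
    move=> k; rewrite /F; case: asboolP => [/hb //|_].
    by rewrite measure0 lee_fin.
  rewrite lee_fin -[size _]/(size (index_enum _)).
  have -> : size (index_enum {ffun 'I_m -> 'I_N}) = (N ^ m)%N.
    by rewrite [index_enum _]unlock -enumT -cardT card_ffun !card_ord.
  rewrite powRB ?(gt_eqF r0) ?implybT // -[m%:R / delta]mul1r.
  have -> : 1 * (m%:R / delta) = 1 / delta * m%:R by rewrite !mul1r mulrC.
  rewrite powRrM powR_mulrn ?powR_ge0 // -/s.
  rewrite [leRHS](_ : _ = ((2 * M + 2) / s) ^+ m * (c * r `^ gamma)).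
    by rewrite ler_wpM2r // natrX lerXn2r // nnegrE ?divr_ge0 //; lra.
  by rewrite expr_div_n; ring.
Qed.

(** * The hitting probability bound *)

(* [hits v I A] is in general only analytic, hence measurable for the
   completion of P; [mu_ext P] is the outer measure of P, which extends the
   completion of P. *)
Theorem proposition2p3 (R : realType) (disp : measure_display)
    (T : measurableType disp) (P : probability T R) (m d : nat)
    (m_ge1 : (1 <= m)%N) (d_ge1 : (1 <= d)%N)
    (v : 'rV[R]_m -> T -> 'rV[R]_d)
    (v_rv : forall x, measurable_fun [set: T] (v x : T -> borel_rV R d))
    (v_cont : forall w : T, continuous (fun x => v x w))
    (I : set 'rV[R]_m) (I_compact : compact I)
    (I_pos : (0 < lebesgue_rV I)%E)
    (delta : R) (delta_gt0 : 0 < delta)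
    (D : set 'rV[R]_d) (gamma : R) (gamma_gt0 : 0 < gamma)
    (hit_bound : exists2 c : R, 0 < c &
       \forall e \near 0^'+,
         forall (z : 'rV[R]_d) (j : 'I_m -> int),
           enlargement D 1 z ->
           grid_box delta e j `&` I !=set0 ->
           (P (hits v (grid_box delta e j) (eball z e))
              <= (c * e `^ gamma)%:E)%E) :
  exists2 C : R, 0 < C &
    forall A : set 'rV[R]_d,
      measurable (A : set (borel_rV R d)) -> A `<=` D ->
      (mu_ext P (hits v I A) <= C%:E * hausdorff (gamma - m%:R / delta) A)%E.
Proof.
case: hit_bound => c c0 [e0 /= e0_gt0 hb].
have [M M0 IM] := compact_coord_bounded I_compact.
set g := gamma - m%:R / delta.
pose C := c * (2 * M + 2) ^+ m.
have C0 : 0 < C by rewrite mulr_gt0 // exprn_gt0 //; lra.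
exists C => // A _ AD.
have [g0|g0] := ltP g 0.
  by rewrite /hausdorff g0 gt0_muley ?lte_fin // leey.
(* Below [e0] the hypothesis applies; radii below 1 keep the centers in the
   1-enlargement of [D]. *)
pose e := Num.min e0 1 / 2.
have [e_gt0 e_lt0 e_lt1] : [/\ 0 < e, e < e0 & e < 1].
  have : 0 < Num.min e0 1 by rewrite lt_min e0_gt0 ltr01.
  have : Num.min e0 1 <= e0 by rewrite ge_min lexx.
  have : Num.min e0 1 <= 1 by rewrite ge_min lexx orbT.
  by rewrite /e => *; split; lra.
apply: (@le_trans _ _ (C%:E * hausdorff_pre g e A)%E); last first.
  by rewrite lee_pmul2l ?lte_fin // hausdorff_pre_le.
rewrite -lee_pdivrMl //; apply/ereal_infP => _ [x [r [re Ar ->]]].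
rewrite lee_pdivrMl // -nneseriesZl; last first.
  by move=> i _; rewrite lee_fin hausdorff_weight_ge0.
have UP i : exists U : set T, [/\ measurable U,
    hits v I (A `&` eball (x i) (r i)) `<=` U &
    (P U <= C%:E * (hausdorff_weight g (r i))%:E)%E].
  have /andP[ri0 rie] := re i.
  (* A ball that misses [A], in particular one of radius 0, costs nothing. *)
  have hits_empty : eball (x i) (r i) `&` A = set0 ->
      hits v I (A `&` eball (x i) (r i)) `<=` set0.
    by rewrite setIC => -> w [y []].
  have [/hits_empty hA|] := eqVneq (eball (x i) (r i) `&` A) set0.
    exists set0; split=> //.
    by rewrite measure0 -EFinM lee_fin mulr_ge0 ?hausdorff_weight_ge0 // ltW.
  move=> /set0P[a [/= xa Aa]].
  have r0 : 0 < r i by apply: le_lt_trans xa; exact: enorm_ge0.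
  have Dx : enlargement D 1 (x i).
    exists a; first exact: AD.
    by rewrite enorm_distC (lt_trans xa) // (le_lt_trans rie).
  have [||U [mU hU PU]] := @hits_ball_cover R disp T P m d v I delta gamma c M
    (x i) (r i) v_rv v_cont delta_gt0 c0 M0 IM.
  - by rewrite r0 (le_trans rie) // ltW.
  - move=> j; apply: hb => //=.
    by rewrite sub0r normrN gtr0_norm // (le_lt_trans rie).
  exists U; split=> //.
    by apply: subset_trans hU => w [y [? [_ ?]]]; exists y.
  apply: (le_trans PU); rewrite -EFinM lee_fin -/C ler_pM2l //.
  rewrite /hausdorff_weight gt_eqF //.
  (* [r i] against the diameter [2 * r i]: this is where [0 <= g] is used. *)
  by apply: ge0_ler_powR => //; rewrite ?nnegrE; lra.
have [U {}UP] := choice UP.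
have PU i : (P (U i) <= C%:E * (hausdorff_weight g (r i))%:E)%E by case: (UP i).
apply: (@le_trans _ _ (\sum_(0 <= i <oo) P (U i))%E); last exact: lee_nneseries.
apply: ereal_inf_lbound; exists U => //; split; first by move=> i; case: (UP i).
move=> w [y [vy Ay]]; have [i _ xi] := Ar _ Ay.
by exists i => //; case: (UP i) => _ + _; apply; exists y.
Qed.
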